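(* Let $$\mathcal K_{1234}=\Psi_{q^2}\big(e^{p_2+u_2+p_4-u_4-2p_3}\big)\Psi_q\big(e^{p_1+u_1+p_3-u_3-p_2}\big)\Psi_{q^2}\big(e^{p_2+u_2+p_4-u_4-2p_3}\big)^{-1}\rho_{24}\,e^{\frac1\hbar p_1(u_4-u_2)}.$$ In the $u$-representation, for all $a_i,b_i\in\mathbb Z$, $$K^{a_1,a_2,a_3,a_4}_{b_1,b_2,b_3,b_4}:=\langle a_1,a_2,a_3,a_4|\mathcal K_{1234}|b_1,b_2,b_3,b_4\rangle=q^{(\ast)}(-1)^{a_2-b_4}\frac{(q^{-4(a_2+b_2-a_4-b_4)};q^4)_{b_2-a_4}}{(q^4;q^4)_{b_2-a_4}(q^2;q^2)_{a_2+b_2-a_4-b_4}}\,\delta^{a_2+a_3+a_4}_{b_2+b_3+b_4}\,\delta^{a_1+2a_2+a_3}_{b_1+2b_2+b_3},$$ where $(\ast)=(a_2+b_2-a_4-b_4)(b_1+2b_2-b_3-2b_4+1)+2(b_2-a_4)(a_2-a_4+1)$.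
   Context: $\hbar$ is a generic complex parameter, $q=e^\hbar$. $[p_i,u_i]=\hbar$ for $i=1,3$, $[p_i,u_i]=2\hbar$ for $i=2,4$, all other commutators among $p_1,\dots,p_4,u_1,\dots,u_4$ vanish; exponentials of linear combinations follow $e^Ae^B=e^{[A,B]/2}e^{A+B}$. $u$-representation: on $V=\bigoplus_{a\in\mathbb Z}\mathbb C|a\rangle$, for the $i$-th tensor factor of $V^{\otimes4}$, $e^{p_i}|a_i\rangle=|a_i-1\rangle$, and $u_i|a_i\rangle=\hbar a_i|a_i\rangle$ for $i=1,3$, $u_i|a_i\rangle=2\hbar a_i|a_i\rangle$ for $i=2,4$ (so $e^{u_i}|a_i\rangle=q^{a_i}|a_i\rangle$, resp. $q^{2a_i}|a_i\rangle$). $\rho_{24}$ exchanges the second and fourth components. $|a_1,\dots,a_4\rangle=|a_1\rangle\otimes\cdots\otimes|a_4\rangle$; $\langle a_i|$ is the dual basis. $\Psi_q(U)=\sum_{n\ge0}\frac{(-qU)^n}{(q^2;q^2)_n}$, $\Psi_q(U)^{-1}=\sum_{n\ge0}\frac{q^{n^2}U^n}{(q^2;q^2)_n}$, and $\Psi_{q^2}$ is the same with $q\to q^2$ (matrix elements are computed termwise). $(z;q)_n=(z;q)_\infty/(zq^n;q)_\infty$ for $n\in\mathbb Z$ with $(z;q)_\infty=\prod_{k\ge0}(1-zq^k)$; $1/(q;q)_n=0$ for $n<0$, so that the right-hand side is zero if $b_2-a_4<0$ or $a_2+b_2-a_4-b_4<0$. $\delta^a_b$ is the Kronecker delta. *)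

(* Defs.v *)
From HB Require Import structures.
From mathcomp Require Import all_boot all_order all_algebra.
From mathcomp Require Import all_classical all_reals all_analysis.
From mathcomp Require Import complex.
From mathcomp Require Import freeg.
From mathcomp Require Import ring zify.

Set Implicit Arguments.
Unset Strict Implicit.
Unset Printing Implicit Defensive.

Import Order.TTheory GRing.Theory Num.Theory.
Import numFieldNormedType.Exports.

Local Open Scope classical_set_scope.
Local Open Scope ring_scope.

(** * Complex exponential *)

Definition cexp (R : realType) (z : R[i]) : R[i] :=
  let: (x +i* y)%C := z in (expR x * cos y +i* (expR x * sin y))%C.

Lemma cexp0 (R : realType) : cexp (0 : R[i]) = 1.
Proof. by rewrite /cexp /= expR0 cos0 sin0 mulr0 mulr1. Qed.

Lemma cexpD (R : realType) (x y : R[i]) : cexp (x + y) = cexp x * cexp y.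
Proof.
case: x y => [a b] [c d]; rewrite /cexp /= expRD cosD sinD.
by apply/eqP; rewrite eq_complex /=; apply/andP; split; apply/eqP; ring.
Qed.

(* "hbar is generic": q = e^hbar is not a root of unity, which is exactly what
   makes all the denominators (q^2;q^2)_n and (q^4;q^4)_n nonzero. *)
Definition generic (R : realType) (hbar : R[i]) : Prop :=
  forall n : nat, (0 < n)%N -> cexp hbar ^+ n != 1.

(** * q-Pochhammer symbols *)

(* (z;q)_n = (z;q)_oo / (z q^n;q)_oo for n : int, with the common factors of
   the two infinite products cancelled (cf. [qpoch_ratio]); for z = q^-k the
   uncancelled quotient would be 0 / 0.  If n < 0 then (q;q)_n is the inverse
   of a product containing the factor 0; since 0^-1 = 0 this gives
   1 / (q;q)_n = 0, as it should be. *)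
Definition qpoch (F : fieldType) (z q : F) (n : int) : F :=
  match n with
  | Posz k => \prod_(i < k) (1 - z * q ^+ i)
  | Negz k => (\prod_(i < k.+1) (1 - z * q ^- i.+1))^-1
  end.

Lemma qpoch_ratio (F : numFieldType) (z q : F) (n : int) (l l' : F) :
  q != 0 -> l' != 0 ->
  (fun N : nat => \prod_(k < N) (1 - z * q ^+ k)) @ \oo --> l ->
  (fun N : nat => \prod_(k < N) (1 - z * q ^ n * q ^+ k)) @ \oo --> l' ->
  qpoch z q n = l / l'.
Proof.
move=> q0 l'0 cl cl'.
have split (y : F) m N : \prod_(k < m + N) (1 - y * q ^+ k) =
    \prod_(k < m) (1 - y * q ^+ k) * \prod_(k < N) (1 - y * q ^+ m * q ^+ k).
  rewrite big_split_ord /=; congr (_ * _).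
  by apply: eq_bigr => k _; rewrite exprD mulrA.
have shift (v : nat -> F) (m : nat) (x : F) :
    v @ \oo --> x -> v (m + N)%N @[N --> \oo] --> x.
  move=> vx; have -> : (fun N => v (m + N)%N) = (fun N => v (N + m)%N).
    by apply/funext => N; rewrite addnC.
  by rewrite cvg_shiftn.
case: n cl' => m /= cl'.
- apply: (mulIf l'0); rewrite divfK //.
  have := shift _ m _ cl; under eq_fun do rewrite split.
  move=> cl2; apply: esym; apply: (@norm_cvg_unique F F _ _ _ _ cl2).
  exact: cvgMl_tmp.
- set d := \prod_(i < m.+1) _.
  have dE : \prod_(i < m.+1) (1 - z * q ^ Negz m * q ^+ i) = d.
    rewrite /d (reindex_inj rev_ord_inj) /=; apply: eq_bigr => i _.
    rewrite subSS NegzE -exprnN -mulrA; congr (1 - _ * _).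
    have im : (i <= m)%N by rewrite -ltnS.
    have {1}-> : m.+1 = (i.+1 + (m - i))%N by rewrite addSn subnKC.
    by rewrite exprD invfM -mulrA mulVf ?mulr1 // expf_neq0.
  have l'E : l' = d * l.
    have := shift _ m.+1 _ cl'; under eq_fun do rewrite split dE.
    have -> : z * q ^ Negz m * q ^+ m.+1 = z.
      by rewrite NegzE -exprnN -mulrA mulVf ?mulr1 // expf_neq0.
    move=> cl2; apply: (@norm_cvg_unique F F _ _ _ _ cl2).
    exact: cvgMl_tmp.
  move: l'0; rewrite l'E mulf_eq0 negb_or => /andP[d0 l0].
  by rewrite invfM mulrCA mulfV ?mulr1.
Qed.

(** * The u-representation on V^{(x)4} *)

(* V^{(x)4} is the free module on the basis |a1> (x) ... (x) |a4>, indexed by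
   the row vector (a1, ..., a4); columns are numbered from 0, so the i-th
   tensor factor is column i - 1. *)
Definition site (a1 a2 a3 a4 : int) : 'rV[int]_4 :=
  \row_(j < 4) nth 0 [:: a1; a2; a3; a4] j.

Definition V4 (R : realType) := {freeg 'rV[int]_4 / R[i]}.

Definition ket (R : realType) (a : 'rV[int]_4) : V4 R := << a >>.

Definition linext (R : realType) (f : 'rV[int]_4 -> V4 R) : V4 R -> V4 R :=
  fglift f.

Lemma linextE (R : realType) (f : 'rV[int]_4 -> V4 R) a :
  linext f (ket R a) = f a.
Proof. by rewrite /linext /ket liftU scale1r. Qed.

Lemma linext_is_linear (R : realType) (f : 'rV[int]_4 -> V4 R) :
  linear (linext f).
Proof.
have addf : additive (linext f) by exact: lift_is_additive.
pose g := GRing.isAdditive.Build _ _ (linext f) addf.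
have fD x y : linext f (x + y) = linext f x + linext f y.
  pose h : {additive V4 R -> V4 R} := HB.pack (linext f) g.
  exact: (raddfD h).
have fS (I : Type) (r : seq I) (F : I -> V4 R) :
    linext f (\sum_(i <- r) F i) = \sum_(i <- r) linext f (F i).
  pose h : {additive V4 R -> V4 R} := HB.pack (linext f) g.
  exact: (raddf_sum h).
move=> c x y; rewrite fD; congr (_ + _).
have cU k z : c *: (<< k *g z >> : V4 R) = << c * k *g z >>.
  by apply/eqP/freeg_eqP => w; rewrite coeffZ !coeffU mulrA.
rewrite -[x]freeg_sumE scaler_sumr !fS scaler_sumr.
by apply: eq_bigr => z _; rewrite cU /linext !liftU scalerA.
Qed.

HB.instance Definition _ (R : realType) (f : 'rV[int]_4 -> V4 R) :=
  GRing.isLinear.Build R[i] (V4 R) (V4 R) *:%R (linext f) (linext_is_linear f).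

(* The pair (c, d) stands for \sum_i (c_i p_i + d_i u_i). *)
Definition lincomb := ('rV[int]_4 * 'rV[int]_4)%type.

Definition p (i : nat) : lincomb := (\row_(j < 4) (j.+1 == i)%:R, 0).
Definition u (i : nat) : lincomb := (0, \row_(j < 4) (j.+1 == i)%:R).

(* hbar for the tensor factors 1, 3 and 2 hbar for the factors 2, 4. *)
Definition hb (R : realType) (hbar : R[i]) (j : 'I_4) : R[i] :=
  if odd j then 2 * hbar else hbar.

Definition comm (R : realType) (hbar : R[i]) (x y : lincomb) : R[i] :=
  \sum_(j < 4) hb hbar j * (x.1 0 j * y.2 0 j - x.2 0 j * y.1 0 j)%:~R.

(* Eigenvalue of \sum_i d_i u_i on |a>. *)
Definition ueig (R : realType) (hbar : R[i]) (d a : 'rV[int]_4) : R[i] :=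
  \sum_(j < 4) (d 0 j)%:~R * (hb hbar j * (a 0 j)%:~R).

(* With x = A + B, A = \sum_i c_i p_i, B = \sum_i d_i u_i, this is
   e^x = e^{- [A, B] / 2} e^A e^B. *)
Definition expop (R : realType) (hbar : R[i]) (x : lincomb) : V4 R -> V4 R :=
  linext (fun a => (cexp (- comm hbar (x.1, 0) (0, x.2) / 2)
                    * cexp (ueig hbar x.2 a)) *: ket R (a - x.1)).

HB.instance Definition _ (R : realType) (hbar : R[i]) (x : lincomb) :=
  GRing.Linear.on (expop hbar x).

Lemma expop_p (R : realType) (hbar : R[i]) (i : nat) a :
  expop hbar (p i) (ket R a) = ket R (a - (p i).1).
Proof.
rewrite /expop linextE /comm /ueig /=.
rewrite big1 => [|j _]; last by rewrite !mxE mulr0 mul0r subrr mulr0.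
rewrite big1 => [|j _]; last by rewrite !mxE mul0r.
by rewrite oppr0 mul0r cexp0 mulr1 scale1r.
Qed.

Lemma expop_u (R : realType) (hbar : R[i]) (i : nat) a :
  expop hbar (u i) (ket R a) = cexp (ueig hbar (u i).2 a) *: ket R a.
Proof.
rewrite /expop linextE /comm /= subr0 big1 => [|j _].
  by rewrite oppr0 mul0r cexp0 mul1r.
by rewrite !mxE !mul0r subrr mulr0.
Qed.

Lemma expopM (R : realType) (hbar : R[i]) (x y : lincomb) a :
  expop hbar x (expop hbar y (ket R a)) =
  cexp (comm hbar x y / 2) *: expop hbar (x + y) (ket R a).
Proof.
rewrite /expop linextE linearZ /= !linextE !scalerA.
have -> : a - y.1 - x.1 = a - (x.1 + y.1) by rewrite opprD addrCA addrC addrAC.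
congr (_ *: _); rewrite -!cexpD; congr cexp.
apply: (@mulIf _ 2); first by rewrite pnatr_eq0.
rewrite !mulrDl !divfK ?pnatr_eq0 // /comm /ueig /=.
rewrite !mulr_suml -!sumrN -!big_split /=; apply: eq_bigr => j _.
rewrite !mxE !(rmorphB, rmorphD, rmorphM) /= !rmorph0; ring.
Qed.

Definition rho24 (R : realType) : V4 R -> V4 R :=
  linext (fun a => ket R (site (a 0 0) (a 0 3) (a 0 2) (a 0 1))).

Lemma ueig_u4u2 (R : realType) (hbar : R[i]) a :
  ueig hbar (u 4 - u 2).2 a = hbar * (2 * (a 0 3 - a 0 1))%:~R.
Proof.
rewrite /ueig !big_ord_recl big_ord0 /= !mxE /hb /=.
have -> : fintype.lift ord0 (fintype.lift ord0 (fintype.lift ord0 ord0))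
    = 3 :> 'I_4.
  exact/val_inj.
have -> : fintype.lift ord0 (ord0 : 'I_3) = 1 by apply/val_inj.
by rewrite !(rmorphB, rmorphM, rmorph0, rmorph1) /=; ring.
Qed.

(* (u_4 - u_2) / hbar has the integer eigenvalue 2 (a_4 - a_2) on |a>
   (cf. [ueig_u4u2]), so e^{p_1 (u_4 - u_2) / hbar} acts on |a> as
   e^{2 (a_4 - a_2) p_1}. *)
Definition exp_p1_u4u2 (R : realType) (hbar : R[i]) : V4 R -> V4 R :=
  linext (fun a => expop hbar (p 1 *~ (2 * (a 0 3 - a 0 1))) (ket R a)).

(** * Infinite series of operators and their matrix elements *)

(* Formal infinite sums of operators, multiplied by distributing over the
   terms. *)
Record opseries (R : realType) := OpSeries {
  idx : choiceType;
  term : idx -> V4 R -> V4 R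
}.

Definition ops (R : realType) (X : V4 R -> V4 R) : opseries R :=
  @OpSeries R unit (fun=> X).

Definition opsM (R : realType) (A B : opseries R) : opseries R :=
  @OpSeries R (idx A * idx B)%type (fun t => term t.1 \o term t.2).

Notation "A ** B" := (opsM A B) (at level 40, left associativity).

(* <a| A |b>, computed termwise.  The sum \sum_(t \in _) over a possibly
   infinite set is meaningful when only finitely many terms are nonzero, which
   is the case for K1234 by [K1234_summable]. *)
Definition matel (R : realType) (a : 'rV[int]_4) (A : opseries R)
    (b : 'rV[int]_4) : R[i] :=
  \sum_(t \in [set: idx A]) coeff a (term t (ket R b)).

Definition Psi (R : realType) (q : R[i]) (X : V4 R -> V4 R) : opseries R :=
  @OpSeries R nat (fun n v =>
    ((- q) ^+ n / qpoch (q ^+ 2) (q ^+ 2) n) *: iter n X v).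

(* The inverse of Psi q X. *)
Definition PsiV (R : realType) (q : R[i]) (X : V4 R -> V4 R) : opseries R :=
  @OpSeries R nat (fun n v =>
    (q ^+ (n ^ 2) / qpoch (q ^+ 2) (q ^+ 2) n) *: iter n X v).

Definition K1234 (R : realType) (hbar : R[i]) : opseries R :=
  let q := cexp hbar in
  let W := expop hbar (p 2 + u 2 + p 4 - u 4 - p 3 *+ 2) in
  let U := expop hbar (p 1 + u 1 + p 3 - u 3 - p 2) in
  Psi (q ^+ 2) W ** Psi q U ** PsiV (q ^+ 2) W
  ** ops (@rho24 R) ** ops (exp_p1_u4u2 hbar).

Lemma K1234_summable (R : realType) (hbar : R[i]) (a b : 'rV[int]_4) :
  finite_set [set t : idx (K1234 hbar) | coeff a (term t (ket R b)) != 0].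
Proof.
have E n x s : exists c : R[i],
    iter n (expop hbar x) (ket R s) = c *: ket R (s - x.1 *+ n).
  elim: n => [|n [c IH]]; first by exists 1; rewrite mulr0n subr0 scale1r.
  rewrite iterS IH linearZ /= {1}/expop linextE scalerA.
  have -> : s - x.1 *+ n - x.1 = s - x.1 *+ n.+1 by rewrite mulrSr opprD addrA.
  by eexists.
have iterZ n x c v : iter n (expop hbar x) (c *: v) =
    c *: iter n (expop hbar x) v.
  by elim: n => [//|n IH]; rewrite !iterS IH linearZ.
pose M := (absz (b 0 1 - a 0 3)%R).+1.
pose N := (absz (b 0 0 - 2 * (b 0 3 - b 0 1) - a 0 0)%R).+1.
apply: (@sub_finite_set _ _ (`I_M `*` `I_N `*` `I_M `*` setT `*` setT)); last first.
  by do !apply: finite_setX; try exact: finite_II; exact: finite_finset.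
move=> [[[[l m] n] []] []].
rewrite /K1234 /Psi /PsiV /ops /=.
set w := p 2 + u 2 + p 4 - u 4 - p 3 *+ 2; set v := p 1 + u 1 + p 3 - u 3 - p 2.
rewrite /exp_p1_u4u2 linextE.
have [c0 /= ->] := E 1%N (p 1 *~ (2 * (b 0 3 - b 0 1))) b.
have rhoZ c (x : V4 R) : rho24 (c *: x) = c *: rho24 x by rewrite /rho24 linearZ.
rewrite rhoZ /rho24 linextE.
set s0 := site _ _ _ _.
rewrite iterZ; have [c1 ->] := E n w s0.
rewrite !iterZ; have [c2 ->] := E m v (s0 - w.1 *+ n).
rewrite !iterZ; have [c3 ->] := E l w (s0 - w.1 *+ n - v.1 *+ m).
rewrite !scalerA coeffZ coeffU mulf_eq0 mul1r negb_or => /andP[_].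
rewrite pnatr_eq0 eqb0 negbK => /eqP sa.
have fstMn (x : lincomb) k : (x *+ k).1 = x.1 *+ k.
  by elim: k => [//|k IH]; rewrite !mulrS /= -IH.
have fstMz (x : lincomb) k j : (x *~ k).1 0 j = x.1 0 j * k.
  case: k => k; rewrite ?NegzE /intmul /= ?mxE fstMn mulmxnE.
    by rewrite -mulr_natr natz.
  by rewrite -mulr_natr mulrN natz.
have w0 : w.1 0 0 = 0 by rewrite /w /p /u /= !mxE.
have w3 : w.1 0 3 = 1 by rewrite /w /p /u /= !mxE.
have v0 : v.1 0 0 = 1 by rewrite /v /p /u /= !mxE.
have v3 : v.1 0 3 = 0 by rewrite /v /p /u /= !mxE.
have entry j : s0 0 j - w.1 0 j *+ n - v.1 0 j *+ m - w.1 0 j *+ l = a 0 j.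
  by rewrite -sa !(mxE, mulmxnE).
have := entry 3; rewrite w3 v3 /s0 !mxE /= mulr1n fstMz mxE /= mul0r.
have := entry 0; rewrite w0 v0 /s0 !mxE /= mulr1n fstMz mxE /= mul1r.
rewrite /M /N !mul0rn !natz => e0 e3.
by do !split; lia.
Qed.

(* Main.v *)
Require Import Defs.
From HB Require Import structures.
From mathcomp Require Import all_boot all_order all_algebra.
From mathcomp Require Import all_classical all_reals all_analysis.
From mathcomp Require Import complex.
From mathcomp Require Import freeg.
From mathcomp Require Import ring zify.

Set Implicit Arguments.
Unset Strict Implicit.
Unset Printing Implicit Defensive.

Import Order.TTheory GRing.Theory Num.Theory.

Local Open Scope ring_scope.

(** Each exponential in K1234 maps a basis vector to a multiple of a basis
    vector.  In <a| K1234 |b>, let l, m, n be the summation indices of the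
    three series, from left to right.  Comparing the components of the basis
    vectors forces m = a2 + b2 - a4 - b4 and l + n = b2 - a4 together with the
    two Kronecker deltas, so that a sum over n in 0 .. b2 - a4 remains.  With
    Q = q^4 and z = Q^-m, this sum is the q-binomial expansion
    \sum_n (-1)^n Q^(n(n-1)/2) z^n / ((Q;Q)_n (Q;Q)_(s-n)) = (z;Q)_s / (Q;Q)_s
    for s = b2 - a4. *)

Lemma prod1B_exp_neq0 (F : fieldType) (Q : F) (n : nat) :
  (forall k : nat, (0 < k)%N -> Q ^+ k != 1) ->
  \prod_(i < n) (1 - Q * Q ^+ i) != 0.
Proof.
move=> Qgen; apply/prodf_neq0 => i _.
by rewrite -exprS subr_eq0 eq_sym Qgen.
Qed.

Lemma qpoch_self_lt0 (F : fieldType) (Q : F) (n : int) :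
  Q != 0 -> n < 0 -> qpoch Q Q n = 0.
Proof.
case: n => // n Q0 _ /=.
by rewrite big_ord_recl expr1 mulfV // subrr mul0r invr0.
Qed.

(** Twice the exponent of Q in the q-binomial sum, free of halving and subtraction, so that [ring]
    can use it when powers of q are compared. *)
Lemma mul2_binn2 (n : nat) : ('C(n, 2) * 2 + n = n * n)%N.
Proof. by elim: n => [|n IH] //; rewrite binS bin1; lia. Qed.

Lemma qbinomial (F : fieldType) (Q z : F) (s : nat) :
  (forall k : nat, (0 < k)%N -> Q ^+ k != 1) ->
  \sum_(n < s.+1) (-1) ^+ n * Q ^+ 'C(n, 2) * z ^+ n
     / (qpoch Q Q n * qpoch Q Q (s - n)%N) = qpoch z Q s / qpoch Q Q s.
Proof.
move=> Qgen; have nz n := prod1B_exp_neq0 n Qgen.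
elim: s => [|s IH].
  by rewrite big_ord1 /= !big_ord0 bin0n !expr0 !mulr1.
rewrite /= in IH *.
(* With F_s the sum, 1 - Q^(s+1) = (1 - Q^(s+1-n)) + Q^(s+1-n) (1 - Q^n) and a
   shift of n in the second part give (1 - Q^(s+1)) F_(s+1) = (1 - z Q^s) F_s. *)
have Qs : 1 - Q * Q ^+ s != 0 by rewrite -exprS subr_eq0 eq_sym Qgen.
apply: (mulfI Qs).
rewrite [in RHS]big_ord_recr /= [X in _ / X]big_ord_recr /=.
transitivity ((1 - z * Q ^+ s) * (\prod_(i < s) (1 - z * Q ^+ i)
    / \prod_(i < s) (1 - Q * Q ^+ i))); last by field; rewrite ?nz ?Qs.
rewrite -IH !mulr_sumr.
pose P n := \prod_(i < n) (1 - Q * Q ^+ i).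
rewrite -/(P _).
have PS n : P n.+1 = P n * (1 - Q * Q ^+ n) by rewrite /P big_ord_recr.
pose T n := (-1) ^+ n * Q ^+ 'C(n, 2) * z ^+ n / (P n * P (s.+1 - n)%N).
transitivity (\sum_(n < s.+2) ((1 - Q ^+ (s.+1 - n)) * T n
                               + Q ^+ (s.+1 - n) * (1 - Q ^+ n) * T n)).
  apply: eq_bigr => n _; rewrite -mulrDl -/(T n); congr (_ * _).
  have /subnK E : (n <= s.+1)%N by rewrite -ltnS.
  by rewrite mulrBr mulr1 -exprD E -exprS; ring.
(* The factor 1 - Q^0 kills the last term of the first sum and the first term of the second. Both
   then have s + 1 terms, the second with n shifted by one. *)
rewrite big_split /= big_ord_recr /= subnn subrr mul0r addr0.
rewrite [X in _ + X]big_ord_recl /= subrr mulr0 mul0r add0r.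
rewrite -big_split /=; apply: eq_bigr => -[n ns] _ /=.
rewrite /T /bump add1n subSS subSn // PS PS -/(P n) -/(P (s - n)%N) binS bin1.
(* Lets [field] treat [Q ^+ n] and [Q ^+ (s - n)] as independent. *)
have E : Q ^+ s = Q ^+ n * Q ^+ (s - n) by rewrite -exprD subnKC.
rewrite E !exprS exprD.
have := Qgen n.+1 isT; have := Qgen (s - n).+1 isT.
rewrite ![in X in X -> _]exprS ![in X in _ -> X -> _]exprS => h1 h2.
field.
by rewrite !nz ![_ - _ == 0]subr_eq0 ![1 == _]eq_sym h1 h2.
Qed.

Lemma cexp_neq0 (R : realType) (z : R[i]) : cexp z != 0.
Proof.
have : cexp z * cexp (- z) != 0 by rewrite -cexpD subrr cexp0 oner_neq0.
by rewrite mulf_eq0 negb_or => /andP[].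
Qed.

Lemma cexpMint (R : realType) (hbar : R[i]) (k : int) :
  cexp (hbar * k%:~R) = cexp hbar ^ k.
Proof.
have nat_case n : cexp (hbar * n%:R) = cexp hbar ^+ n.
  elim: n => [|n IH]; first by rewrite mulr0 cexp0 expr0.
  by rewrite exprSr -IH -natr1 mulrDr mulr1 cexpD.
case: k => n; first exact: nat_case.
rewrite NegzE rmorphN mulrN -exprnN -nat_case.
apply: (mulfI (cexp_neq0 (hbar * n.+1%:R))).
by rewrite -cexpD subrr cexp0 mulfV // cexp_neq0.
Qed.

Lemma eq_site a1 a2 a3 a4 b1 b2 b3 b4 :
  (site a1 a2 a3 a4 == site b1 b2 b3 b4)
    = [&& a1 == b1, a2 == b2, a3 == b3 & a4 == b4].
Proof.
apply/eqP/and4P => [E|[/eqP-> /eqP-> /eqP-> /eqP->] //].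
have e j := congr1 (fun x : 'rV_4 => x 0 j) E.
by have := (e 0, e 1, e 2, e 3); rewrite !mxE /= => -[[[-> ->] ->] ->].
Qed.

(** The exponents of the operators inside Psi_{q^2} and Psi_q; the digits name the tensor factors
    whose u_i occur. *)
Definition w24 : lincomb := p 2 + u 2 + p 4 - u 4 - p 3 *+ 2.
Definition w13 : lincomb := p 1 + u 1 + p 3 - u 3 - p 2.

(** The commutators 2 hbar and -2 hbar from factors 2 and 4 cancel, so only the eigenvalue of u_2 -
    u_4 contributes. For [w13], hbar and -hbar from factors 1 and 3 cancel likewise. *)
Lemma expop_w24 (R : realType) (hbar : R[i]) a1 a2 a3 a4 :
  expop hbar w24 (ket R (site a1 a2 a3 a4))
  = cexp hbar ^ (2 * (a2 - a4)) *: ket R (site a1 (a2 - 1) (a3 + 2) (a4 - 1)).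
Proof.
rewrite /expop linextE; congr (_ *: _); last first.
  congr ket; apply/rowP => j; rewrite !mxE.
  by case: j => [[|[|[|[|]]]] ?] //=; lia.
rewrite -cexpD -cexpMint; congr cexp.
rewrite /comm /ueig /w24 !big_ord_recl !big_ord0 /hb /= !mxE /=.
rewrite !(rmorphB, rmorphD, rmorphN, rmorphM, rmorph0, rmorph1) /=.
by field.
Qed.

Lemma expop_w13 (R : realType) (hbar : R[i]) a1 a2 a3 a4 :
  expop hbar w13 (ket R (site a1 a2 a3 a4))
  = cexp hbar ^ (a1 - a3) *: ket R (site (a1 - 1) (a2 + 1) (a3 - 1) a4).
Proof.
rewrite /expop linextE; congr (_ *: _); last first.
  congr ket; apply/rowP => j; rewrite !mxE.
  by case: j => [[|[|[|[|]]]] ?] //=; lia.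
rewrite -cexpD -cexpMint; congr cexp.
rewrite /comm /ueig /w13 !big_ord_recl !big_ord0 /hb /= !mxE /=.
rewrite !(rmorphB, rmorphD, rmorphN, rmorphM, rmorph0, rmorph1) /=.
by field.
Qed.

(** Each application lowers a2 and a4 together and so contributes the same power of q; the exponent
    is linear in n. For [w13] the same holds with a1 and a3. *)
Lemma iter_expop_w24 (R : realType) (hbar : R[i]) (n : nat) a1 a2 a3 a4 :
  iter n (expop hbar w24) (ket R (site a1 a2 a3 a4))
  = cexp hbar ^ (2 * n%:Z * (a2 - a4))
    *: ket R (site a1 (a2 - n%:Z) (a3 + 2 * n%:Z) (a4 - n%:Z)).
Proof.
have q0 : cexp hbar != 0 := cexp_neq0 hbar.
elim: n => [|n IH].
  rewrite -[LHS]scale1r -(expr0z (cexp hbar)).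
  by congr (_ ^ _ *: ket R (site _ _ _ _)); lia.
rewrite iterS IH linearZ /= expop_w24 scalerA -expfzDr //.
by congr (_ ^ _ *: ket R (site _ _ _ _)); lia.
Qed.

Lemma iter_expop_w13 (R : realType) (hbar : R[i]) (n : nat) a1 a2 a3 a4 :
  iter n (expop hbar w13) (ket R (site a1 a2 a3 a4))
  = cexp hbar ^ (n%:Z * (a1 - a3))
    *: ket R (site (a1 - n%:Z) (a2 + n%:Z) (a3 - n%:Z) a4).
Proof.
have q0 : cexp hbar != 0 := cexp_neq0 hbar.
elim: n => [|n IH].
  rewrite -[LHS]scale1r -(expr0z (cexp hbar)).
  by congr (_ ^ _ *: ket R (site _ _ _ _)); lia.
rewrite iterS IH linearZ /= expop_w13 scalerA -expfzDr //.
by congr (_ ^ _ *: ket R (site _ _ _ _)); lia.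
Qed.

Lemma iter_expopZ (R : realType) (hbar : R[i]) (n : nat) x c (v : V4 R) :
  iter n (expop hbar x) (c *: v) = c *: iter n (expop hbar x) v.
Proof. by elim: n => [//|n IH]; rewrite !iterS IH linearZ. Qed.

Lemma rho24_exp_p1_u4u2 (R : realType) (hbar : R[i]) b1 b2 b3 b4 :
  rho24 (exp_p1_u4u2 hbar (ket R (site b1 b2 b3 b4)))
  = ket R (site (b1 + 2 * b2 - 2 * b4) b4 b3 b2).
Proof.
have fstMz (x : lincomb) k : (x *~ k).1 = x.1 *~ k by exact: (raddfMz fst).
have sndMz (x : lincomb) k : (x *~ k).2 = x.2 *~ k by exact: (raddfMz snd).
rewrite /exp_p1_u4u2 linextE; set k := (2 * _)%R.
have -> : p 1 *~ k = (\row_(j < 4) (k * (j.+1 == 1)%:R), 0).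
  rewrite [LHS]surjective_pairing fstMz sndMz mul0rz; congr pair.
  by apply/rowP => j; rewrite -scaler_int !mxE intz.
rewrite /expop linextE /comm /ueig /=.
(* The exponent has no u part, so the scalar is 1. *)
rewrite big1 => [|j _]; last by rewrite !mxE mulr0 mul0r subrr mulr0.
rewrite big1 => [|j _]; last by rewrite !mxE mul0r.
rewrite oppr0 mul0r cexp0 mulr1 scale1r /rho24 linextE.
congr (ket R (site _ _ _ _)); rewrite !mxE /= ?mulr0 ?subr0 //.
by rewrite /k !mxE /=; lia.
Qed.

(** The operators act from right to left, and each summand of the exponent is taken at the basis
    vector reached so far. All of them together conserve a2 + a3 + a4 and a1 + 2 a2 + a3, whence the
    last two equations. *)
Lemma coeff_term_K1234 (R : realType) (hbar : R[i]) (l m n : nat)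
    a1 a2 a3 a4 b1 b2 b3 b4 :
  let q := cexp hbar in
  coeff (site a1 a2 a3 a4)
    (@term _ (K1234 hbar) (l, m, n, tt, tt) (ket R (site b1 b2 b3 b4)))
  = (- q ^+ 2) ^+ l / qpoch (q ^+ 4) (q ^+ 4) l
    * ((- q) ^+ m / qpoch (q ^+ 2) (q ^+ 2) m)
    * ((q ^+ 2) ^+ (n ^ 2) / qpoch (q ^+ 4) (q ^+ 4) n)
    * q ^ (2 * n%:Z * (b4 - b2) + m%:Z * (b1 + 2 * b2 - 2 * b4 - b3 - 2 * n%:Z)
           + 2 * l%:Z * (b4 + m%:Z - b2))
    * [&& n%:Z + l%:Z == b2 - a4, m%:Z == a2 + b2 - a4 - b4,
          a2 + a3 + a4 == b2 + b3 + b4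
        & a1 + 2 * a2 + a3 == b1 + 2 * b2 + b3]%:R.
Proof.
move=> q; have q0 : q != 0 := cexp_neq0 hbar.
rewrite /K1234 /Psi /PsiV /ops /= -/w24 -/w13 -/q -!exprM.
rewrite rho24_exp_p1_u4u2 iter_expop_w24 !iter_expopZ iter_expop_w13.
rewrite !iter_expopZ iter_expop_w24 !scalerA coeffZ coeffU mul1r eq_site.
congr (_ * _); last by congr ((nat_of_bool _)%:R); lia.
rewrite !expfzDr // (_ : (2 * 2)%N = 4%N) //.
rewrite (_ : b4 - n%:Z + m%:Z - (b2 - n%:Z) = b4 + m%:Z - b2); last by lia.
by rewrite [b3 + _]addrC opprD [- (2 * n%:Z) - _]addrC !addrA -!mulrA.
Qed.

Theorem proposition6p6 (R : realType) (hbar : R[i]) (hgen : generic hbar)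
    (a1 a2 a3 a4 b1 b2 b3 b4 : int) :
  let q := cexp hbar in
  matel (site a1 a2 a3 a4) (K1234 hbar) (site b1 b2 b3 b4) =
  q ^ ((a2 + b2 - a4 - b4) * (b1 + 2 * b2 - b3 - 2 * b4 + 1)
       + 2 * (b2 - a4) * (a2 - a4 + 1))
  * (-1) ^ (a2 - b4)
  * (qpoch (q ^ (- 4 * (a2 + b2 - a4 - b4))) (q ^+ 4) (b2 - a4)
     / (qpoch (q ^+ 4) (q ^+ 4) (b2 - a4)
        * qpoch (q ^+ 2) (q ^+ 2) (a2 + b2 - a4 - b4)))
  * (a2 + a3 + a4 == b2 + b3 + b4)%:R
  * (a1 + 2 * a2 + a3 == b1 + 2 * b2 + b3)%:R.
Proof.
move=> q; have q0 : q != 0 := cexp_neq0 hbar.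
have qXgen k n : (0 < k)%N -> (0 < n)%N -> (q ^+ k) ^+ n != 1.
  by move=> k0 n0; rewrite -exprM hgen // muln_gt0 k0.
rewrite -[RHS]mulrA -natrM mulnb /matel.
(* As l, m, n are natural numbers, a negative value forced on m or l + n, or a failing delta, leaves
   no nonzero term. *)
have term0 : ~~ [&& 0 <= b2 - a4, 0 <= a2 + b2 - a4 - b4,
    a2 + a3 + a4 == b2 + b3 + b4 & a1 + 2 * a2 + a3 == b1 + 2 * b2 + b3] ->
    \sum_(t \in [set: idx (K1234 hbar)])
      coeff (site a1 a2 a3 a4) (term t (ket R (site b1 b2 b3 b4))) = 0.
  move=> H; apply: fsbig1 => -[[[[l m] n] []] []] _.
  rewrite coeff_term_K1234 (_ : [&& _, _, _ & _] = false) ?mulr0 //.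
  by apply: contraNF H => /and4P[/eqP <- /eqP <- -> ->].
have [D|nD] := boolP (_ && _); last first.
  by rewrite mulr0 term0 // negb_and negb_and nD !orbT.
rewrite mulr1.
have [m_lt0|] := ltP (a2 + b2 - a4 - b4) 0.
  (* On the right, [qpoch] at a negative index is 0, and so is its inverse since 0^-1 = 0. *)
  rewrite (qpoch_self_lt0 (expf_neq0 2 q0) m_lt0) mulr0 invr0 !mulr0 term0 //.
  by rewrite (lt_geF m_lt0) andbF.
have [s_lt0 _|] := ltP (b2 - a4) 0.
  rewrite (qpoch_self_lt0 (expf_neq0 4 q0) s_lt0) mul0r invr0 !mulr0 term0 //.
  by rewrite (lt_geF s_lt0).
case s_def : (b2 - a4) => [s|//] _.
case m_def : (a2 + b2 - a4 - b4) => [m|//] _.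
(* The only indices that can contribute: m is fixed and l = s - n. *)
pose tm (n : nat) : idx (K1234 hbar) := ((s - n)%N, m, n, tt, tt).
rewrite (fsbigE (map tm (iota 0 s.+1))); first last.
- move=> [[[[l m'] n] []] []] _ tr; rewrite coeff_term_K1234.
  rewrite (_ : [&& _, _, _ & _] = false) ?mulr0 //.
  apply: contraNF tr => /and4P[/eqP sE /eqP mE _ _].
  by apply/mapP; exists n; rewrite ?mem_iota /tm; [lia | repeat f_equal; lia].
- by [].
- by rewrite map_inj_uniq ?iota_uniq // => n n' [].
rewrite big_map (eq_bigl xpredT) => [|n]; last by rewrite in_setT.
rewrite -[iota 0 _]/(iota 0 (s.+1 - 0)) -/(index_iota 0 s.+1) big_mkord.
have sgn : (-1) ^ (a2 - b4) = (-1) ^+ m * (-1) ^+ s :> R[i].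
  rewrite (_ : a2 - b4 = m%:Z - s%:Z); last by lia.
  by rewrite expfzDr ?oppr_eq0 ?oner_eq0 // -exprnN -exprVn invrN1.
have qbin := qbinomial (q ^ (- 4 * m%:Z)) s (fun n => @qXgen 4%N n isT).
transitivity (q ^ (m%:Z * (b1 + 2 * b2 - b3 - 2 * b4 + 1)
                   + 2 * s%:Z * (a2 - a4 + 1))
   * (-1) ^ (a2 - b4) / qpoch (q ^+ 2) (q ^+ 2) m
   * (qpoch (q ^ (- 4 * m%:Z)) (q ^+ 4) s / qpoch (q ^+ 4) (q ^+ 4) s));
  last by rewrite invfM; ring.
rewrite -qbin mulr_sumr; apply: eq_bigr => -[n ns] _.
rewrite -[nat_of_ord _]/n coeff_term_K1234 -/q D andbT m_def s_def eqxx andbT.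
rewrite (_ : (_ == _) = true) ?mulr1; last by apply/eqP; lia.
(* Replaces the truncated s - n by k with k + n = s. *)
move: (s - n)%N (subnK (ns : (n <= s)%N) : (s - n + n)%N = s) => k sE.
move: (qpoch _ _ k) (qpoch _ _ n) (qpoch _ _ m) => X Z Y.
set A := (X in _ * q ^ X = _); set B := (X in _ = q ^ X * _ / _ * _).
(* All powers of q, apart from the Pochhammer symbols. Once b2 and b4 are eliminated and s = k + n,
   the comparison reduces to 2 n^2 - 2 n = 4 C(n,2). *)
have pow : (q ^+ 2) ^+ k * q ^+ m * (q ^+ 2) ^+ (n ^ 2) * q ^ A
    = q ^ B * (q ^+ 4) ^+ 'C(n, 2) * (q ^ (- 4 * m%:Z)) ^+ n.
  rewrite -!exprM !exprnP exprz_exp -!expfzDr // /A /B; congr (_ ^ _).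
  have -> : b4 = a2 + s%:Z - m%:Z by lia.
  have -> : b2 = s%:Z + a4 by lia.
  have /(congr1 Posz) := mul2_binn2 n; rewrite -sE expnS expn1 !PoszD !PoszM.
  by move=> /esym cE; ring: cE.
rewrite sgn -sE exprD (exprNn q) (exprNn (q ^+ 2)) invfM.
transitivity ((-1) ^+ k * (-1) ^+ m * X^-1 * Y^-1 * Z^-1
  * ((q ^+ 2) ^+ k * q ^+ m * (q ^+ 2) ^+ (n ^ 2) * q ^ A)).
  by move: (q ^ A) (_ ^+ (n ^ 2)) => *; ring.
(* The prefactor brings (-1)^(k + n) and the q-binomial term (-1)^n, which leaves (-1)^k. *)
have nn : (-1) ^+ n * (-1) ^+ n = 1 :> R[i] by rewrite -expr2 sqrr_sign.
rewrite pow; move: (q ^ B) ((q ^ _) ^+ n) ((q ^+ 4) ^+ _) => *.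
by move: ((-1) ^+ n) nn => e ee; ring: ee.
Qed.
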